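(* Let $m,n,a$ be positive integers with $m\ge 2$. The number of standard Young tableaux of battery shape $[(m^n),a,2]$ is equal to $$f^{(m^n)}\;{}_3F_2(a,m,-n;\,1,-mn;\,1),$$ where $f^{(m^n)}$ is the number of standard Young tableaux of rectangular shape $(m^n)$ and ${}_3F_2$ is the (terminating) generalized hypergeometric function, i.e. ${}_3F_2(a,m,-n;1,-mn;1)=\sum_{t=0}^{n}\frac{(a)_t\,(m)_t\,(-n)_t}{(1)_t\,(-mn)_t}\frac{1}{t!}$.
   Context: $(m^n)$ denotes the partition with $n$ parts all equal to $m$ (Young diagram with $n$ rows and $m$ columns; row 1 is the top row). For a partition $\lambda$ of a positive integer $N$, and integers $a\ge 1$, $1\le k\le \lambda_1$, the battery shape $[\lambda,a,k]$ (of size $N+a$) is obtained from the Young diagram $[\lambda]$ (left-justified rows) by adding a column of $a$ cells directly above the top cell of the $k$-th column. In coordinates, $[(m^n),a,k]$ consists of the cells $(i,j)$ with $1\le i\le n$, $1\le j\le m$, together with the cells $(0,k),(-1,k),\dots,(1-a,k)$, where the first coordinate is the row (increasing downwards) and the second the column. A standard Young tableau (SYT) of a shape with $M$ cells is a bijection from the set of cells to $\{1,\dots,M\}$ such that entries increase from left to right in each row and from top to bottom in each column (including the added cells). Pochhammer symbol: $(x)_0=1$ and $(x)_t=x(x+1)\cdots(x+t-1)$ for $t\ge 1$. When an upper parameter $-p$ and a lower parameter $-q$ are non-positive integers with $0\le p\le q$, the generalized hypergeometric series $\sum_t \frac{\prod_i (a_i)_t}{\prod_j (b_j)_t}\frac{z^t}{t!}$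 is by definition truncated to $0\le t\le p$. *)

(* Defs.v *)
From mathcomp Require Import all_boot all_order all_algebra.
From mathcomp Require Import finmap.

Set Implicit Arguments.
Unset Strict Implicit.
Unset Printing Implicit Defensive.

Import Order.TTheory GRing.Theory Num.Theory.
Local Open Scope fset_scope.
Local Open Scope ring_scope.

(* A cell is a pair (row, column); rows increase downwards and may be zero or
   negative, and the top row and the first column of a Young diagram have
   index 1. *)
Definition cell := (int * nat)%type.

(* A partition is given by the weakly decreasing sequence of its parts. *)
Definition young_diagram (la : seq nat) : {fset cell} :=
  [fset ((i%:Z, j) : cell) | i in iota 1 (size la), j in iota 1 (nth 0%N la i.-1)].

(* The added cells lie in rows 0, -1, ..., 1 - a. *)
Definition battery_shape (la : seq nat) (a k : nat) : {fset cell} :=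
  young_diagram la `|` [fset ((1 - t%:Z, k) : cell) | t in iota 1 a].

(* The entry of the cell c is (T c).+1, so that entries range over
   {1, ..., #|` S|}. *)
Definition filling (S : {fset cell}) := {ffun S -> 'I_#|` S|}.

Definition bijective_filling (S : {fset cell}) (T : filling S) : bool :=
  injectiveb T && [forall v, exists c, T c == v].

Definition row_increasing (S : {fset cell}) (T : filling S) : bool :=
  [forall c : S, forall d : S,
    ((val c).1 == (val d).1) && ((val c).2 < (val d).2)%N ==> (T c < T d)%N].

Definition column_increasing (S : {fset cell}) (T : filling S) : bool :=
  [forall c : S, forall d : S,
    ((val c).2 == (val d).2) && ((val c).1 < (val d).1) ==> (T c < T d)%N].

Definition standard_tableaux (S : {fset cell}) : {set filling S} :=
  [set T | [&& bijective_filling T, row_increasing T & column_increasing T]].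

Definition num_syt (S : {fset cell}) : nat := #|standard_tableaux S|.

Definition pochhammer (F : fieldType) (x : F) (t : nat) : F :=
  \prod_(i < t) (x + i%:R).

(* The generalized hypergeometric series with upper parameters us, lower
   parameters ls and argument z, truncated to 0 <= t <= p.  It is the
   terminating series when -p is an upper parameter. *)
Definition hypergeometric (F : fieldType) (p : nat) (us ls : seq F) (z : F) : F :=
  \sum_(0 <= t < p.+1)
    (\prod_(u <- us) pochhammer u t) / (\prod_(l <- ls) pochhammer l t)
    * (z ^+ t / t`!%:R).

(* Main.v *)
Require Import Defs.
From mathcomp Require Import all_boot all_order all_algebra.
From mathcomp Require Import finmap.
From mathcomp Require Import zify ring.

(** Tableaux are counted by the place of the entry 1, which occupies a minimal
    cell: the number of tableaux of a shape is the sum, over its minimal cells,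
    of the number of tableaux of the shape without that cell
    ([num_syt_peel]).  Everything below is an iteration of this recursion.

    In the battery shape, as long as the tower above column 2 is not empty, the
    cell (1, 2) and the cells to its right or below are blocked.  Hence the
    smallest entries fill the tower from the top and, independently, the first
    column of the rectangle from the top.  Let M_k be the number of tableaux of
    the rectangle without the k top cells of its first column.  When the last
    cell of the tower is filled, after k cells of the first column, there
    remain M_k ways to finish and there were C(a + k - 1, k) ways to
    interleave; so the count is the sum over k of C(a + k - 1, k) M_k
    ([num_syt_notched_battery]), where C(a + k - 1, k) = (a)_k / k!.

    It remains to compute the ratio M_k / M_0.  The notched rectangle is a
    Young diagram rotated by a half-turn: its rows are right-justified, of lengths
    nu_0 <= ... <= nu_{n-1}.  For such shapes the formula of Frobenius
      N! prod_{i < j} (l_j - l_i) / prod_i l_i!,   l_i = nu_i + i,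
    holds ([num_syt_right_rows]).  By the peeling recursion it amounts to
      sum_i l_i V(l - e_i) = (sum_i l_i - C(n, 2)) V(l)
    for the Vandermonde determinant V ([sum_Vandermonde_shift]): the index i
    contributes 0 unless row i starts with a minimal cell.  Passing from M_k to
    M_{k+1} lowers the single entry l_k, which gives
      (k + 1) (m n - k) M_{k+1} = (m + k) (n - k) M_k
    ([num_syt_notchedS]); this is exactly the ratio of consecutive terms
    (m)_k (-n)_k / ((1)_k (-mn)_k). *)

Set Implicit Arguments.
Unset Strict Implicit.
Unset Printing Implicit Defensive.

Import GRing.Theory Num.Theory.
Local Open Scope fset_scope.
Local Open Scope ring_scope.

(** * Moving one entry of a Vandermonde determinant *)

Definition shift_entry (R : comNzRingType) n (l : 'rV[R]_n) (i : 'I_n) (t : R) :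
    'rV[R]_n :=
  \row_j (if j == i then l 0 j + t else l 0 j).

Lemma cofactor_shift_entry (R : comNzRingType) n (l : 'rV[R]_n) i t (k : 'I_n) :
  cofactor (Vandermonde n (shift_entry l i t)) k i = cofactor (Vandermonde n l) k i.
Proof.
rewrite /cofactor; congr (_ * \det _); apply/matrixP=> r c.
by rewrite !mxE eq_sym (negPf (neq_lift i c)).
Qed.

Lemma coef_XaddCn_pred (R : comNzRingType) (t : R) k :
  ('X * ('X + t%:P) ^+ k)`_k = t *+ k.
Proof.
rewrite coefXM; case: k => [|k] //=.
rewrite addrC exprDn coef_sum (bigD1 (Ordinal (leqW (ltnSn k)))) //= big1 ?addr0.
  by rewrite subSnn expr1 coefMn coefCM coefXn eqxx mulr1 binSn.
move=> i /negPf nik; rewrite -rmorphXn coefMn coefCM coefXn.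
have -> : (k == i) = false by rewrite eq_sym -nik.
by rewrite mulr0 mul0rn.
Qed.

(** Expanding the i-th determinant along its i-th column turns the left-hand
    side into the trace of [\adj V *m W], where W has entries
    l_i (l_i + t)^k.  The exponents k are below n, so the polynomials
    X (X + t)^k have degree below n except for the last one, which may be
    reduced modulo the product r of the X - l_j as r vanishes at every l_i.
    Thus W = A V with A the matrix of coefficients of these polynomials, and
    the trace is \det V times \tr A. *)
Lemma sum_Vandermonde_shift (R : comNzRingType) n (l : 'rV[R]_n) (t : R) :
  \sum_i l 0 i * \det (Vandermonde n (shift_entry l i t)) =
  (\sum_i l 0 i + t *+ 'C(n, 2)) * \det (Vandermonde n l).
Proof.
case: n l => [|n] l; first by rewrite !big_ord0 addr0 mul0r.
set V := Vandermonde _ l.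
pose r := \prod_(j < n.+1) ('X - (l 0 j)%:P).
pose q k := 'X * ('X + t%:P) ^+ k : {poly R}.
pose p (k : 'I_n.+1) := q k - (if k == ord_max then r else 0).
have mon_q k : q k \is monic by rewrite monicMl ?monicX // monic_exp // monicXaddC.
have size_q k : size (q k) = k.+2.
  rewrite /q size_Mmonic ?monic_exp ?monicXaddC ?polyX_eq0 // size_polyX.
  by rewrite -[t]opprK polyCN size_exp_XsubC.
have mon_r : r \is monic by apply: monic_prod_XsubC.
have size_r : size r = n.+2.
  by rewrite /r size_prod_XsubC /index_enum -enumT size_enum_ord.
have size_p k : (size (p k) <= n.+1)%N.
  rewrite /p; case: eqP => [->|/eqP nk] /=; last first.
    rewrite subr0 size_q; move: (ltn_ord k) nk.
    by rewrite -val_eqE /=; lia.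
  apply/leq_sizeP=> j; rewrite leq_eqVlt => /predU1P[<-|lt_nj]; rewrite coefB.
    move: (monicP mon_r) (monicP (mon_q n)).
    by rewrite !lead_coefE size_r size_q => -> ->; rewrite subrr.
  by rewrite !nth_default ?subrr ?size_r ?size_q.
pose A := \matrix_(k < n.+1, j < n.+1) (p k)`_j.
have AVE k i : (A *m V) k i = l 0 i * (l 0 i + t) ^+ k.
  have -> : (A *m V) k i = (p k).[l 0 i].
    by rewrite (horner_coef_wide _ (size_p k)) mxE; apply: eq_bigr => j _; rewrite !mxE.
  have r0 : r.[l 0 i] = 0 by rewrite /r horner_prod (bigD1 i) //= !hornerE subrr mul0r.
  rewrite /p /q hornerD hornerN; case: eqP => _;
    by rewrite ?r0 ?horner0 subr0 hornerM horner_exp !hornerE.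
have -> : \sum_i l 0 i * \det (Vandermonde n.+1 (shift_entry l i t)) = \tr (\adj V *m (A *m V)).
  apply: eq_bigr => i _; rewrite (expand_det_col _ i) big_distrr mxE /=.
  apply: eq_bigr => k _; rewrite cofactor_shift_entry AVE !mxE eqxx; ring.
(* The diagonal entries of A are k t, and the last one gains the sum of the
   l_j from the subleading coefficient of r. *)
rewrite mulmxA mxtrace_mulC mulmxA mul_mx_adj mul_scalar_mx mxtraceZ mulrC.
congr (_ * _); rewrite /mxtrace big_ord_recr /=.
under eq_bigr => i _.
  rewrite mxE /p -val_eqE /= (ltn_eqF (ltn_ord i)) subr0 coef_XaddCn_pred.
  over.
rewrite mxE /p eqxx coefB coef_XaddCn_pred /= /r.
have -> : (\prod_(j < n.+1) ('X - (l 0 j)%:P))`_n = - \sum_i l 0 i.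
  have := @coefPn_prod_XsubC R [seq l 0 j | j <- index_enum 'I_n.+1].
  have -> : size [seq l 0 j | j <- index_enum 'I_n.+1] = n.+1.
    by rewrite size_map /index_enum -enumT size_enum_ord.
  by rewrite !big_map => ->.
rewrite opprK addrA addrC; congr (_ + _).
by rewrite -bin2_sum big_mkord -sumrMnr big_ord_recr.
Qed.

(** * Removing the cell of the least entry *)

Definition precedes (d c : cell) : bool :=
  ((d.1 == c.1) && (d.2 < c.2)%N) || ((d.2 == c.2) && (d.1 < c.1)).

Definition minimal_cell (S : {fset cell}) (c : cell) : bool :=
  (c \in S) && [forall d : S, ~~ precedes (val d) c].

(** Injectivity suffices, since the shape and the set of entries have the same
    number of elements. *)
Lemma standard_tableauxE S (T : filling S) :
  (T \in standard_tableaux S) =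
  injectiveb T && [forall c, forall d, precedes (val c) (val d) ==> (T c < T d)%N].
Proof.
rewrite inE /bijective_filling /row_increasing /column_increasing.
case: injectiveP => //= injT.
have -> : [forall v, exists c, T c == v].
  have [g _ gT] : bijective T by apply: inj_card_bij => //; rewrite card_ord -cardfE.
  by apply/forallP=> v; apply/existsP; exists (g v); rewrite gT.
rewrite andTb; apply/andP/forallP => [[/forallP rT /forallP cT] c|pT].
  apply/forallP=> d; apply/implyP=> /orP[h|h].
    by move/forallP: (rT c) => /(_ d) /implyP; apply.
  by move/forallP: (cT c) => /(_ d) /implyP; apply.
split; apply/forallP=> c; apply/forallP=> d; apply/implyP=> h;
  by move/forallP: (pT c) => /(_ d) /implyP; apply; rewrite /precedes h ?orbT.
Qed.

Lemma standard_tableaux_bij S (T : filling S) :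
  T \in standard_tableaux S -> bijective T.
Proof.
rewrite inE => /and3P[/andP[/injectiveP injT _] _ _].
by apply: inj_card_bij => //; rewrite card_ord -cardfE.
Qed.

Section RemoveMinimal.
Variables (S : {fset cell}) (c : S).
Let S' := S `\ val c.

Fact card_fsetD1_val : #|` S'|.+1 = #|` S|.
Proof. by rewrite [in RHS](cardfsD1 (val c)) (valP c). Qed.

Definition extend_filling (T' : filling S') : filling S :=
  [ffun d => cast_ord card_fsetD1_val
     (if insub (val d) is Some d' then lift ord0 (T' d') else ord0)].

Lemma extend_filling_min T' : extend_filling T' c = 0%N :> nat.
Proof. by rewrite ffunE insubF //= !inE eqxx. Qed.

Lemma extend_filling_incl T' (d : S) (d' : S') :
  val d = val d' -> extend_filling T' d = (T' d').+1 :> nat.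
Proof. by move=> e; rewrite ffunE /= e valK /= /bump. Qed.

Variant remove_spec (d : S) : Prop :=
  | RemoveSame of d = c
  | RemoveOther (d' : S') of val d = val d'.

Lemma removeP d : remove_spec d.
Proof.
have [->|ndc] := eqVneq d c; first exact: RemoveSame.
have dS' : val d \in S' by rewrite !inE (valP d) andbT.
exact: (@RemoveOther _ [` dS']).
Qed.

(** Deleting the cell c of the entry 1 and lowering the other entries by 1 is
    inverse to [extend_filling]; minimality of c makes the extension
    standard. *)
Lemma card_least_entry : minimal_cell S (val c) ->
  #|[set T in standard_tableaux S | T c == 0%N :> nat]| = num_syt S'.
Proof.
move=> /andP[_ /forallP min_c].
have inclS (d' : S') : exists d : S, val d = val d'.
  have dS : val d' \in S by have := valP d'; rewrite !inE => /andP[].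
  by exists [` dS].
have inj_ext : injective extend_filling.
  move=> T1 T2 eqT; apply/ffunP=> d'; apply/val_inj.
  have [d dd'] := inclS d'.
  by have [] : (T1 d').+1 = (T2 d').+1 by rewrite -!(extend_filling_incl _ dd') eqT.
rewrite /num_syt -(card_imset _ inj_ext); congr #|pred_of_set _|.
apply/setP=> T; rewrite inE.
apply/andP/imsetP=> [[stT /eqP Tc0]|[T' stT' ->]].
  move: (stT); rewrite standard_tableauxE => /andP[/injectiveP injT /forallP incT].
  have [f fE] : exists f : S' -> 'I_#|` S'|, forall (d' : S') (d : S),
      val d = val d' -> T d = (f d').+1 :> nat.
    apply: (@fin_all_exists S' (fun _ => 'I_#|` S'|) (fun d' v => forall d : S,
      val d = val d' -> T d = v.+1 :> nat)) => d'.
    have [d dd'] := inclS d'.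
    have Td_gt0 : (0 < T d)%N.
      rewrite lt0n -Tc0; apply/negP=> /eqP/val_inj/injT dc.
      by have := valP d'; rewrite -dd' dc !inE eqxx.
    have Td_lt : ((T d).-1 < #|` S'|)%N.
      by rewrite -ltnS card_fsetD1_val prednK.
    exists (Ordinal Td_lt) => e /= ed'.
    have -> : e = d by apply: val_inj; apply: etrans ed' (esym dd').
    by rewrite prednK.
  exists [ffun d' => f d']; last first.
    apply/ffunP=> d; apply: val_inj => /=; have [->|d' dd'] := removeP d.
      by rewrite extend_filling_min.
    by rewrite (extend_filling_incl _ dd') ffunE (fE _ _ dd').
  rewrite standard_tableauxE; apply/andP; split.
    apply/injectiveP=> d' e'; rewrite !ffunE => fde.
    have [d dd'] := inclS d'; have [e ee'] := inclS e'.
    apply: val_inj; rewrite -dd' -ee'; congr val; apply: injT.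
    by apply: val_inj; rewrite /= (fE _ _ dd') (fE _ _ ee') fde.
  apply/forallP=> d'; apply/forallP=> e'; apply/implyP.
  have [d dd'] := inclS d'; have [e ee'] := inclS e'.
  rewrite -dd' -ee' => pde; move/forallP: (incT d) => /(_ e)/implyP/(_ pde).
  by rewrite (fE _ _ dd') (fE _ _ ee') ltnS !ffunE.
rewrite extend_filling_min; split=> //.
move: stT'; rewrite !standard_tableauxE => /andP[/injectiveP injT /forallP incT].
apply/andP; split.
  apply/injectiveP=> d e; move/(congr1 val)=> /=.
  have [->|d' dd'] := removeP d; have [->|e' ee'] := removeP e => //.
  - by rewrite extend_filling_min (extend_filling_incl _ ee').
  - by rewrite extend_filling_min (extend_filling_incl _ dd').
  rewrite (extend_filling_incl _ dd') (extend_filling_incl _ ee').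
  by move=> [/val_inj/injT de]; apply: val_inj; rewrite dd' ee' de.
apply/forallP=> d; apply/forallP=> e; apply/implyP.
have [->|e' ee'] := removeP e; first by rewrite (negPf (min_c d)).
rewrite (extend_filling_incl _ ee').
have [->|d' dd'] := removeP d; first by rewrite extend_filling_min.
rewrite (extend_filling_incl _ dd') dd' ee' ltnS.
by move/forallP: (incT d') => /(_ e')/implyP.
Qed.
End RemoveMinimal.

Lemma num_syt_empty : num_syt fset0 = 1%N.
Proof.
have no_cell (c : fset0 : {fset cell}) : False by have := fsvalP c; rewrite inE.
pose T0 : filling fset0 := [ffun c => False_rect _ (no_cell c)].
apply/eqP/cards1P; exists T0; apply/setP=> T; rewrite standard_tableauxE inE.
have -> : T = T0 by apply/ffunP=> c; case: (no_cell c).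
rewrite eqxx; apply/andP; split; first by apply/injectiveP=> c; case: (no_cell c).
by apply/forallP=> c; case: (no_cell c).
Qed.

(** The cell of the entry 1 is minimal, and by [card_least_entry] each minimal
    cell c holds it in [num_syt (S `\ c)] tableaux.  The minimal cells are
    given as a sequence, to be listed explicitly for each family of shapes. *)
Lemma num_syt_peel (S : {fset cell}) (s : seq cell) : S != fset0 -> uniq s ->
  (forall c, (c \in s) = minimal_cell S c) ->
  num_syt S = (\sum_(c <- s) num_syt (S `\ c))%N.
Proof.
move=> S0 uniq_s sE.
have S_gt0 : (0 < #|` S|)%N by rewrite cardfs_gt0.
have -> : num_syt S =
  (\sum_(c : S) #|[set T in standard_tableaux S | T c == 0%N :> nat]|)%N.
  rewrite /num_syt -sum1_card.
  under [RHS]eq_bigr do rewrite -sum1_card.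
  rewrite (exchange_big_dep (mem (standard_tableaux S))) /=; last first.
    by move=> c T _; rewrite inE => /andP[].
  apply: eq_bigr => T stT.
  have [g Tg gT] := standard_tableaux_bij stT.
  rewrite (eq_bigl (pred1 (g (Ordinal S_gt0)))) ?big_pred1_eq // => c.
  rewrite inE stT /=; apply/eqP/eqP => [Tc0|->]; last by rewrite gT.
  by rewrite -[c]Tg; congr g; apply: val_inj.
rewrite (bigID (fun c : S => val c \in s)) /= addnC big1 ?add0n => [|c]; last first.
  rewrite sE /minimal_cell (valP c) /= negb_forall => /existsP[d].
  rewrite negbK => pdc; apply: eq_card0 => T; rewrite [LHS]inE.
  apply/negP=> /andP[]; rewrite standard_tableauxE => /andP[_ /forallP/(_ d)].
  by move=> /forallP/(_ c); rewrite pdc /= => dc /eqP Tc0; rewrite Tc0 in dc.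
rewrite (eq_bigr (fun c : S => num_syt (S `\ val c))) => [|c]; last first.
  by rewrite sE => /card_least_entry.
rewrite -(big_seq_fsetE _ S (mem s) (fun c => num_syt (S `\ c))) /= -big_filter.
apply: perm_big; apply: uniq_perm; rewrite ?filter_uniq ?fset_uniq // => c.
rewrite mem_filter /=; case: (boolP (c \in s)) => //.
by rewrite sE => /andP[].
Qed.

(** * The formula of Frobenius for right-justified rows *)

Lemma mem_young_rect n m (c : cell) :
  (c \in young_diagram (nseq n m)) = (1 <= c.1 <= n%:Z) && (1 <= c.2 <= m)%N.
Proof.
apply/imfset2P/idP => [[i /= + [j + ->]]|].
  by rewrite size_nseq !mem_iota /= nth_nseq; case: ifP; lia.
case: c => -[i|i] j //= h; exists i; first by rewrite mem_iota size_nseq; lia.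
exists j => //; rewrite mem_iota /= nth_nseq; case: ifP; lia.
Qed.

(** A Young diagram rotated by a half-turn: the i-th row from the top, counted
    from 0, consists of the last [nu i] cells of row i + 1 of the rectangle.
    Turning the diagram makes the removal of minimal cells stay inside the
    family. *)
Definition right_rows n m (nu : nat -> nat) : {fset cell} :=
  [fset c in young_diagram (nseq n m) | (m < c.2 + nu `|c.1|.-1)%N].

Lemma mem_right_rows n m nu (c : cell) :
  (c \in right_rows n m nu) =
  [&& 1 <= c.1 <= n%:Z, (1 <= c.2 <= m)%N & (m < c.2 + nu `|c.1|.-1)%N].
Proof. by rewrite !inE mem_young_rect -!andbA. Qed.

(** Row i starts with a minimal cell when it is longer than the row above it;
    the row above the top one counts as empty. *)
Definition corner (nu : nat -> nat) (i : nat) : bool :=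
  ((if i is i'.+1 then nu i' else 0) < nu i)%N.

Definition decr (nu : nat -> nat) (i j : nat) : nat :=
  if j == i then (nu j).-1 else nu j.

Definition row_lengths n m (nu : nat -> nat) : Prop :=
  (forall i j, (i <= j < n)%N -> (nu i <= nu j)%N) /\
  (forall i, (i < n)%N -> (nu i <= m)%N).

Definition row_start m (nu : nat -> nat) (i : nat) : cell :=
  (i.+1%:Z, (m - nu i).+1).

Lemma corner_lt n m nu i j : row_lengths n m nu -> (i < n)%N -> corner nu i ->
  (j < i)%N -> (nu j < nu i)%N.
Proof.
move=> [mono _]; case: i => [|i] // lt_in; rewrite /corner => cor lt_ji.
by apply: leq_ltn_trans cor; apply: mono; lia.
Qed.

Lemma minimal_right_rows n m nu c : row_lengths n m nu ->
  (c \in [seq row_start m nu i | i <- iota 0 n & corner nu i]) =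
  minimal_cell (right_rows n m nu) c.
Proof.
move=> nuP; have [mono le_nu] := nuP.
apply/mapP/andP => [[i + ->]|[]].
  rewrite mem_filter mem_iota /= add0n => /andP[cor lt_in].
  have le_nui := le_nu i lt_in.
  have gt0 : (0 < nu i)%N by apply: leq_ltn_trans cor.
  split; first by rewrite mem_right_rows /=; lia.
  apply/forallP=> -[[[p|p] q] /= ]; rewrite mem_right_rows /precedes /=; last by lia.
  case: p => [|p] /=; first by lia.
  move=> pq; apply/negP=> /orP[] /andP[/eqP e lt].
    have ep : p = i by lia.
    by move: pq; rewrite ep; lia.
  have lt_pi : (p < i)%N by lia.
  by have := corner_lt nuP lt_in cor lt_pi; lia.
case: c => -[[|i]|p] q; rewrite mem_right_rows /=; try lia.
move=> iq /forallP min_c; exists i; last first.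
  rewrite /row_start; congr (_, _).
  have dS : (i.+1%:Z, (m - nu i).+1) \in right_rows n m nu.
    by rewrite mem_right_rows /=; lia.
  by have := min_c [` dS]; rewrite /precedes /= eqxx; lia.
rewrite mem_filter mem_iota add0n /= /corner.
case: i iq min_c => [|i] iq min_c; first by lia.
have le_i : (nu i <= nu i.+1)%N by apply: mono; lia.
apply/andP; split; last by lia.
rewrite ltn_neqAle le_i andbT; apply/negP=> /eqP e.
have dS : (i.+1%:Z, q) \in right_rows n m nu.
  by rewrite mem_right_rows /=; lia.
by have := min_c [` dS]; rewrite /precedes /= eqxx; lia.
Qed.

Lemma right_rows_remove n m nu i : row_lengths n m nu -> (i < n)%N -> (0 < nu i)%N ->
  right_rows n m nu `\ row_start m nu i = right_rows n m (decr nu i).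
Proof.
move=> [_ le_nu] lt_in gt0; have le_nui := le_nu i lt_in.
apply/fsetP=> -[[[|p]|p] q]; rewrite !in_fsetD1 !mem_right_rows /row_start /=;
  rewrite ?andbF // xpair_eqE /decr.
case: (eqVneq p i) => [->|ne]; first by rewrite eqxx /=; lia.
have -> : (p.+1%:Z == i.+1%:Z) = false by lia.
by [].
Qed.

Lemma decr_row_lengths n m nu i : row_lengths n m nu -> (i < n)%N -> corner nu i ->
  row_lengths n m (decr nu i).
Proof.
move=> nuP lt_in cor; have [mono le_nu] := nuP.
split=> [p q pq|p lt_pn]; last by rewrite /decr; have := le_nu p lt_pn; case: eqP; lia.
have := mono p q pq; rewrite /decr; case: (eqVneq p i) => [->|np].
  by case: (eqVneq q i); lia.
case: (eqVneq q i) => [eq|]; last by lia.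
have lt_pi : (p < i)%N by lia.
by have := corner_lt nuP lt_in cor lt_pi; rewrite eq; lia.
Qed.

(** The distinct numbers l_i = nu_i + i of the formula of Frobenius. *)
Definition shifted n (nu : nat -> nat) : 'rV[rat]_n := \row_i (nu i + i)%:R.

Lemma shifted_decr n (nu : nat -> nat) (i : 'I_n) : (0 < nu i)%N ->
  shifted n (decr nu i) = shift_entry (shifted n nu) i (- 1).
Proof.
move=> gt0; apply/rowP=> j; rewrite !mxE /decr val_eqE.
case: eqP => // ->.
by rewrite -[in RHS](prednK gt0) addSn -natr1 addrK.
Qed.

Lemma det_Vandermonde_eq0 (R : comNzRingType) n (l : 'rV[R]_n) (i j : 'I_n) :
  i != j -> l 0 i = l 0 j -> \det (Vandermonde n l) = 0.
Proof.
move=> nij eq_l; rewrite -det_tr; apply: (determinant_alternate nij) => k.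
by rewrite !mxE eq_l.
Qed.

(** If row i does not start with a minimal cell, either i = 0 and l_0 = 0, or
    l_i - 1 = l_(i-1) and two entries of the shifted vector coincide. *)
Lemma shifted_decr_noncorner n m nu (i : 'I_n) : row_lengths n m nu ->
  ~~ corner nu i ->
  shifted n nu 0 i * \det (Vandermonde n (shift_entry (shifted n nu) i (- 1))) = 0.
Proof.
move=> [mono _]; rewrite /corner -leqNgt; case: i => -[|i] lt_in /= ncor.
  by rewrite mxE /=; move: ncor; rewrite leqn0 => /eqP->; rewrite mul0r.
have lt_in' : (i < n)%N by lia.
have eq_nu : nu i.+1 = nu i.
  by apply/eqP; rewrite eqn_leq ncor mono //; lia.
rewrite [X in _ * X](@det_Vandermonde_eq0 _ _ _ (Ordinal lt_in') (Ordinal lt_in)).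
- by rewrite mulr0.
- by rewrite -val_eqE /=; lia.
rewrite !mxE eqxx -val_eqE /= (_ : i == i.+1 = false); last by lia.
by rewrite eq_nu addnS -natr1 addrK.
Qed.

Lemma det_shifted0 n :
  \det (Vandermonde n (shifted n (fun=> 0%N))) = \prod_(i < n) i`!%:R.
Proof.
rewrite det_Vandermonde (exchange_big_dep predT) //=.
apply: eq_bigr => j _; rewrite (big_ord_narrow (ltnW (ltn_ord j))).
rewrite fact_prod big_add1 big_mkord natr_prod (reindex_inj rev_ord_inj) /=.
apply: eq_bigr => i _; rewrite !mxE /= -natrB; last by lia.
by have lt_ij := ltn_ord i; congr _%:R; rewrite !add0n subKn.
Qed.

Lemma sum_decr n (nu : nat -> nat) (i : 'I_n) : (0 < nu i)%N ->
  (\sum_(j < n) nu j = (\sum_(j < n) decr nu i j).+1)%N.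
Proof.
move=> gt0; rewrite (bigD1 i) //= [in RHS](bigD1 i) //= [decr nu i i]/decr eqxx.
rewrite -addSn prednK //; congr (_ + _)%N; apply: eq_bigr => j.
by rewrite /decr -val_eqE /= => /negPf->.
Qed.

Lemma prod_fact_decr n (nu : nat -> nat) (i : 'I_n) : (0 < nu i)%N ->
  \prod_(j < n) (nu j + j)`!%:R =
  (nu i + i)%:R * \prod_(j < n) (decr nu i j + j)`!%:R :> rat.
Proof.
move=> gt0; rewrite (bigD1 i) //= [in RHS](bigD1 i) //= [decr nu i i]/decr eqxx mulrA.
congr (_ * _); last by apply: eq_bigr => j; rewrite /decr -val_eqE /= => /negPf->.
by rewrite -natrM -[in LHS](prednK gt0) addSn factS -addSn prednK.
Qed.

Lemma right_rows_neq0 n m nu (i : 'I_n) : row_lengths n m nu -> (0 < nu i)%N ->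
  right_rows n m nu != fset0.
Proof.
move=> [_ /(_ i (ltn_ord i)) le_nui] gt0; apply/fset0Pn; exists (i.+1%:Z, m).
by rewrite mem_right_rows /=; have := ltn_ord i; lia.
Qed.

(** Induction on the number of cells: peeling row i replaces l_i by l_i - 1,
    which divides the product of the l_j! by l_i.  Rows that cannot be peeled
    contribute 0, so the sum may be taken over all rows and is given by
    [sum_Vandermonde_shift] with t = -1. *)
Theorem num_syt_right_rows n m (nu : nat -> nat) : row_lengths n m nu ->
  (num_syt (right_rows n m nu))%:R =
  (\sum_(i < n) nu i)`!%:R * \det (Vandermonde n (shifted n nu))
    / \prod_(i < n) (nu i + i)`!%:R :> rat.
Proof.
move: {2}(\sum_(i < n) nu i)%N (erefl (\sum_(i < n) nu i)%N) => N.
elim: N nu => [|N IH] nu sumE nuP.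
  have nu0 (i : 'I_n) : nu i = 0%N.
    by apply/eqP; rewrite -leqn0 -sumE (bigD1 i) //= leq_addr.
  have -> : right_rows n m nu = fset0.
    apply/fsetP=> -[[[|p]|p] q]; rewrite mem_right_rows inE /=; try lia.
    case: (ltnP p n) => [lt_pn|]; last by lia.
    by rewrite (nu0 (Ordinal lt_pn)); lia.
  rewrite num_syt_empty sumE mul1r.
  have -> : shifted n nu = shifted n (fun=> 0%N).
    by apply/rowP=> i; rewrite !mxE nu0.
  rewrite det_shifted0; under [X in _ / X]eq_bigr do rewrite nu0.
  rewrite divff //; apply/prodf_neq0=> i _; by rewrite pnatr_eq0 -lt0n fact_gt0.
set P := \prod_(i < n) _.
rewrite (@num_syt_peel _ [seq row_start m nu i | i <- iota 0 n & corner nu i]).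
- rewrite big_map big_filter sumE factS natrM.
  (* N + 1 is the first factor in [sum_Vandermonde_shift], because the sum of the
     l_i exceeds that of the nu_i by C(n, 2). *)
  have -> : (N.+1)%:R = \sum_i shifted n nu 0 i + (-1) *+ 'C(n, 2).
    rewrite -sumE -bin2_sum big_mkord mulNrn.
    under [X in _ = X - _]eq_bigr do rewrite mxE natrD.
    by rewrite big_split /= !natr_sum addrK.
  rewrite [_ * N`!%:R]mulrC -[_ * _ * \det _]mulrA -sum_Vandermonde_shift.
  rewrite natr_sum big_distrr big_distrl /=.
  have -> : iota 0 n = index_iota 0 n by rewrite /index_iota subn0.
  rewrite big_mkord big_mkcond; apply: eq_bigr => i _; case: ifP => [cor|ncor]; last first.
    by rewrite (shifted_decr_noncorner nuP) ?ncor // mulr0 mul0r.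
  have gt0 : (0 < nu i)%N by apply: leq_ltn_trans cor.
  rewrite (right_rows_remove nuP) // IH; last exact: decr_row_lengths.
    have -> : (\sum_(j < n) decr nu i j = N)%N by move: sumE; rewrite (sum_decr gt0) => -[].
    rewrite shifted_decr // /P (prod_fact_decr gt0) mxE -[LHS]mulrA -[RHS]mulrA; congr (_ * _).
    rewrite invfM mulrACA divff ?mul1r // pnatr_eq0; lia.
  by move: sumE; rewrite (sum_decr gt0) => -[].
- have [i gt0] : exists i : 'I_n, (0 < nu i)%N.
    apply/existsP; apply: contraT; rewrite negb_exists => /forallP nu0.
    move: sumE; rewrite big1 // => i _; apply/eqP.
    by have := nu0 i; rewrite -eqn0Ngt.
  exact: right_rows_neq0 gt0.
- rewrite map_inj_uniq ?filter_uniq ?iota_uniq // => i j [].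
  by move=> -> _.
move=> c; exact: minimal_right_rows.
Qed.

(** * Rectangles with a notched first column *)

(** Isolates the factors that change when the entry of index i moves. *)
Lemma det_Vandermonde_entry (R : comNzRingType) n (l : 'rV[R]_n) (i : 'I_n) :
  \det (Vandermonde n l) =
  (\prod_(j < n | (j < i)%N) (l 0 i - l 0 j)) * (\prod_(j < n | (i < j)%N) (l 0 j - l 0 i))
  * \prod_(p < n | p != i) \prod_(q < n | (p < q)%N && (q != i)) (l 0 q - l 0 p).
Proof.
rewrite det_Vandermonde (bigD1 i) //= [RHS]mulrAC mulrC; congr (_ * _).
rewrite [X in X * _](_ : _ =
    \prod_(p < n | p != i) if (p < i)%N then l 0 i - l 0 p else 1); last first.
  rewrite -big_mkcondr; apply: eq_bigl => p; case: (ltnP p i) => //; rewrite ?andbF ?andbT //.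
  by rewrite -val_eqE /=; lia.
rewrite -big_split; apply: eq_bigr => p _ /=; case: ifP => [lt_pi|ge_pi].
  by rewrite (bigD1 i).
rewrite mul1r; apply: eq_bigl => q; case: (eqVneq q i) => [->|_]; by rewrite ?ge_pi ?andbT.
Qed.

Lemma prod_below n k c : (k <= n)%N ->
  (\prod_(j < n | (j < k)%N) (k + c - j) = (k + c) ^_ k)%N.
Proof. by move=> le_kn; rewrite (big_ord_narrow le_kn) ffact_prod. Qed.

Lemma prod_above n k c : (k < n)%N ->
  (\prod_(j < n | (k < j)%N) (j - k + c) = (n - k.+1 + c) ^_ (n - k.+1))%N.
Proof.
move=> lt_kn; rewrite -(@prod_below n) ?leq_subr // (reindex_inj rev_ord_inj) /=.
apply: eq_big => [j|j] /=; have := ltn_ord j; lia.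
Qed.

(** Row lengths of the rectangle without the k top cells of its first
    column. *)
Definition notched m k (i : nat) : nat := if (i < k)%N then m.-1 else m.

Lemma row_lengths_notched n m k : row_lengths n m (notched m k).
Proof. by rewrite /notched; split=> [i j|i]; do ?case: ifP; lia. Qed.

Lemma notchedS m k : notched m k.+1 =1 decr (notched m k) k.
Proof.
move=> i; rewrite /notched /decr ltnS leq_eqVlt.
by case: eqP => [->|] //=; rewrite ltnn.
Qed.

(** The l_j are the integers from m - 1 to m + n - 1 without m + k - 1, the
    value just below l_k = m + k.  The shift moves l_k into this gap, so the
    product of the differences of l_k with the smaller entries goes from
    (k + 1)! to k!, and that with the larger ones from (n - k - 1)! to
    (n - k)!. *)
Lemma det_shift_notched m n (k : 'I_n) : (0 < m)%N ->
  k.+1%:R * \det (Vandermonde n (shift_entry (shifted n (notched m k)) k (-1))) =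
  (n - k)%:R * \det (Vandermonde n (shifted n (notched m k))).
Proof.
move=> m_gt0; have lt_kn := ltn_ord k; set l := shifted _ _.
have lk : l 0 k = (m + k)%:R by rewrite mxE /notched ltnn.
have m1 : m.-1%:R = m%:R - 1 :> rat by rewrite -subn1 natrB.
have below c (x : rat) : x = (m + k)%:R + c%:R - 1 ->
    \prod_(j < n | (j < k)%N) (x - l 0 j) = ((k + c) ^_ k)%:R.
  move=> ->; rewrite -(@prod_below n) 1?ltnW // natr_prod; apply: eq_bigr => j lt_jk.
  rewrite mxE /notched lt_jk natrB; last by lia.
  rewrite !natrD m1; ring.
have above c (x : rat) : x = (m + k)%:R - c%:R ->
    \prod_(j < n | (k < j)%N) (l 0 j - x) = ((n - k.+1 + c) ^_ (n - k.+1))%:R.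
  move=> ->; rewrite -prod_above // natr_prod; apply: eq_bigr => j lt_kj.
  rewrite mxE /notched ltnNge (ltnW lt_kj) /= !natrD natrB 1?ltnW //; ring.
have ffactS p : (p + 1) ^_ p = (p.+1 * p`!)%N.
  by rewrite -factS addn1 -(ffact_fact (leqnSn p)) subSnn muln1.
have offk (P : pred 'I_n) (F : rat -> rat) : (forall j, P j -> j != k) ->
    \prod_(j < n | P j) F (shift_entry l k (-1) 0 j) = \prod_(j < n | P j) F (l 0 j).
  by move=> Pk; apply: eq_bigr => j /Pk /negPf nk; rewrite mxE nk.
pose C (r : 'rV[rat]_n) :=
  \prod_(p < n | p != k) \prod_(q < n | (p < q)%N && (q != k)) (r 0 q - r 0 p).
have off_C : C (shift_entry l k (-1)) = C l.
  apply: eq_bigr => p /negPf nk; rewrite [shift_entry l k (-1) 0 p]mxE nk.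
  by rewrite (offk _ (fun y => y - _)) // => j /andP[].
have atk : shift_entry l k (-1) 0 k = (m + k)%:R - 1 by rewrite mxE eqxx lk.
rewrite !(det_Vandermonde_entry _ k) -!/(C _) atk.
rewrite (offk _ (fun y => _ - y)); last first.
  by move=> j; rewrite -val_eqE => /ltn_eqF /= ->.
rewrite (offk _ (fun y => y - _)); last first.
  by move=> j; rewrite -val_eqE => /gtn_eqF /= ->.
rewrite {}off_C.
rewrite (below 0%N) ?addr0 // (above 1%N) // lk (below 1%N) ?addrK // (above 0%N) ?subr0 //.
rewrite !ffactS !addn0 !ffactnn.
have -> : (n - k = (n - k.+1).+1)%N by lia.
rewrite !natrM; ring.
Qed.

Lemma sum_notched m n k : (k <= n)%N -> (0 < m)%N ->
  (\sum_(i < n) notched m k i = m * n - k)%N.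
Proof.
move=> + m_gt0; elim: k => [|k IH] lt_kn.
  by rewrite subn0 sum_nat_const card_ord mulnC.
have := @sum_decr n (notched m k) (Ordinal lt_kn); rewrite /= {1}/notched ltnn => /(_ m_gt0).
under [in X in _ = X.+1 -> _]eq_bigr do rewrite -notchedS.
by rewrite IH 1?ltnW // => /(congr1 predn) /= <-; lia.
Qed.

(** In the formula of Frobenius, lowering l_k = m + k by 1 multiplies the
    determinant by (n - k) / (k + 1), divides the product of the l_j! by m + k,
    and divides N!, where N = m n - k, by N. *)
Lemma num_syt_notchedS m n k : (0 < m)%N -> (k < n)%N ->
  k.+1%:R * (m * n - k)%:R * (num_syt (right_rows n m (notched m k.+1)))%:R =
  (m + k)%:R * (n - k)%:R * (num_syt (right_rows n m (notched m k)))%:R :> rat.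
Proof.
move=> m_gt0 lt_kn; pose i := Ordinal lt_kn.
have gt0 : (0 < notched m k i)%N by rewrite /notched ltnn.
rewrite !num_syt_right_rows; try exact: row_lengths_notched.
rewrite !sum_notched // 1?ltnW //.
have -> : shifted n (notched m k.+1) = shift_entry (shifted n (notched m k)) i (-1).
  by rewrite -(shifted_decr gt0); apply/rowP=> j; rewrite !mxE notchedS.
rewrite (prod_fact_decr gt0).
under [X in _ * (_ / X) = _]eq_bigr do rewrite notchedS.
set P := \prod_(j < n) _.
have P0 : P != 0 by apply/prodf_neq0=> j _; rewrite pnatr_eq0 -lt0n fact_gt0.
have -> : notched m k i = m by rewrite /notched ltnn.
have -> : (m * n - k = (m * n - k.+1).+1)%N by nia.
rewrite factS natrM.
have := @det_shift_notched m n i m_gt0; rewrite [nat_of_ord i]/= => detE.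
have mk0 : (m + k)%:R != 0 :> rat by rewrite pnatr_eq0; lia.
move: (\det _) (\det _) mk0 P0 detE => D D' mk0 P0 detE.
set N := (m * n - k.+1)%N; move: N => N.
transitivity (N.+1%:R * N`!%:R / P * (k.+1%:R * D')); first by field.
by rewrite detE; field; rewrite P0 -natrD mk0.
Qed.

Lemma num_syt_notched m n k : (0 < m)%N -> (k <= n)%N ->
  (num_syt (right_rows n m (notched m k)))%:R =
  (num_syt (right_rows n m (notched m 0)))%:R *
    (pochhammer m%:R k * pochhammer (- n%:R) k
     / (pochhammer 1 k * pochhammer (- (m * n)%:R) k)) :> rat.
Proof.
move=> m_gt0; elim: k => [|k IH] lt_kn.
  by rewrite /pochhammer !big_ord0 !mul1r mulr1.
have k0 : k.+1%:R != 0 :> rat by rewrite pnatr_eq0.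
have mnk : (m * n - k)%:R != 0 :> rat by rewrite pnatr_eq0; nia.
apply: (mulfI (mulf_neq0 k0 mnk)); rewrite num_syt_notchedS // IH 1?ltnW //.
have pS (x : rat) : pochhammer x k.+1 = pochhammer x k * (x + k%:R).
  by rewrite /pochhammer big_ord_recr.
rewrite !{}pS; move: (pochhammer _ _) (pochhammer _ _) => X Y.
rewrite !invfM.
have -> : - (m * n)%:R + k%:R = - (m * n - k)%:R :> rat.
  by rewrite natrB; [ring | nia].
have -> : - n%:R + k%:R = - (n - k)%:R :> rat by rewrite natrB 1?ltnW //; ring.
rewrite -natr1 addrC in k0 *; rewrite natrD; move: (_^-1) (_^-1) => Z W.
by field; rewrite k0 mnk.
Qed.

(** * The battery shape *)

Definition notched_battery n m b k : {fset cell} :=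
  right_rows n m (notched m k) `|` [fset ((1 - t%:Z, 2%N) : cell) | t in iota 1 b].

Lemma mem_tower b j (c : cell) :
  (c \in [fset ((1 - t%:Z, j) : cell) | t in iota 1 b]) = (1 - b%:Z <= c.1 <= 0) && (c.2 == j).
Proof.
apply/imfsetP/idP => [[t /=]|]; first by rewrite mem_iota => ht ->; rewrite eqxx andbT /=; lia.
case: c => p q /= /andP[hp /eqP->].
exists `|1 - p|%N; first by rewrite mem_iota; lia.
congr (_, _); lia.
Qed.

Lemma mem_notched_battery n m b k (c : cell) :
  (c \in notched_battery n m b k) =
  [&& 1 <= c.1 <= n%:Z, (1 <= c.2 <= m)%N & (k%:Z < c.1) || (1 < c.2)%N]
  || (1 - b%:Z <= c.1 <= 0) && (c.2 == 2%N).
Proof.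
rewrite in_fsetU mem_tower mem_right_rows; congr (_ || _).
case: c => -[[|p]|p] q //=; rewrite ?/notched; try lia.
by case: (ltnP p k); lia.
Qed.

Lemma battery_shape_notched n m a :
  battery_shape (nseq n m) a 2 = notched_battery n m a 0.
Proof.
apply/fsetP=> -[p q]; rewrite mem_notched_battery in_fsetU mem_tower mem_young_rect /=.
lia.
Qed.

Lemma young_rect_notched n m : young_diagram (nseq n m) = right_rows n m (notched m 0).
Proof.
apply/fsetP=> -[p q]; rewrite mem_right_rows mem_young_rect /notched /=; lia.
Qed.

Lemma notched_battery0 n m k : notched_battery n m 0 k = right_rows n m (notched m k).
Proof.
by apply/fsetP=> c; rewrite in_fsetU mem_tower; case: c => p q /=; lia.
Qed.

(** The minimal cells are the top of the tower and, if any, the top remaining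
    cell of the first column: the other cells have (1, 2), hence the tower,
    or a cell of the first column before them. *)
Lemma num_syt_notched_batteryS n m b k : (2 <= m)%N -> (k <= n)%N ->
  num_syt (notched_battery n m b.+1 k) =
  (num_syt (notched_battery n m b k) +
   (if (k < n)%N then num_syt (notched_battery n m b.+1 k.+1) else 0))%N.
Proof.
move=> m2 le_kn.
pose top : cell := (- b%:Z, 2%N); pose left : cell := (k.+1%:Z, 1%N).
have topS : top \in notched_battery n m b.+1 k by rewrite mem_notched_battery /=; lia.
rewrite (@num_syt_peel _ (top :: (if (k < n)%N then [:: left] else [::]))).
- rewrite big_cons.
  have -> : notched_battery n m b.+1 k `\ top = notched_battery n m b k.
    apply/fsetP=> -[p q]; rewrite in_fsetD1 !mem_notched_battery xpair_eqE /=; lia.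
  case: ifP => lt_kn; last by rewrite big_nil.
  rewrite big_seq1; congr (_ + num_syt _)%N.
  apply/fsetP=> -[p q]; rewrite in_fsetD1 !mem_notched_battery xpair_eqE /=; lia.
- by apply/fset0Pn; exists top.
- by case: ifP => //= _; rewrite inE xpair_eqE /= andbF.
move=> c; apply/idP/andP => [|[]].
  have -> : (c \in top :: (if (k < n)%N then [:: left] else [::])) =
            (c == top) || ((k < n)%N && (c == left)).
    by case: ifP => _; rewrite ?in_cons in_nil ?orbF.
  move=> /orP[/eqP->|/andP[lt_kn /eqP->]]; split=> //.
  - apply/forallP=> -[[p q] /= ]; rewrite mem_notched_battery /precedes /=; lia.
  - by rewrite mem_notched_battery /=; lia.
  apply/forallP=> -[[p q] /= ]; rewrite mem_notched_battery /precedes /=; lia.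
case: c => p q; rewrite mem_notched_battery /= => cS /forallP min_c.
have no_pred d : d \in notched_battery n m b.+1 k -> ~~ precedes d (p, q).
  by move=> dS; have := min_c [` dS].
have := no_pred _ topS; have := no_pred (p, 2%N); have := no_pred left.
rewrite !mem_notched_battery /precedes /= => h1 h2 h3.
have -> : ((p, q) \in top :: (if (k < n)%N then [:: left] else [::])) =
          ((p == - b%:Z) && (q == 2%N)) || [&& (k < n)%N, p == k.+1%:Z & q == 1%N].
  by case: ifP => _; rewrite ?in_cons in_nil ?orbF.
lia.
Qed.

(** The binomial coefficient counts the ways to interleave the removal of the
    b cells of the tower and of j - k cells of the first column, ending with
    the tower.  For b = 0 the truncated predecessor makes it 1 if j = k and 0
    otherwise. *)
Lemma num_syt_notched_battery n m b k : (2 <= m)%N -> (k <= n)%N ->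
  num_syt (notched_battery n m b k) =
  (\sum_(k <= j < n.+1) 'C((b + (j - k)).-1, j - k) *
     num_syt (right_rows n m (notched m j)))%N.
Proof.
move=> m2; elim: b k => [|b IHb] k le_kn.
  rewrite notched_battery0 big_ltn // subnn mul1n big_nat_cond big1 ?addn0 // => j.
  by move=> lt_kj; rewrite add0n bin_small ?mul0n //; lia.
move: {2}(n - k)%N (erefl (n - k)%N) => d; elim: d k le_kn => [|d IHd] k le_kn dE.
  have -> : k = n by lia.
  rewrite num_syt_notched_batteryS // ltnn addn0 IHb // !big_nat1 subnn.
  by rewrite !bin0.
have lt_kn : (k < n)%N by lia.
rewrite num_syt_notched_batteryS // lt_kn IHb // IHd //; last by lia.
rewrite big_ltn // [in RHS]big_ltn // subnn !bin0 -addnA; congr (_ + _)%N.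
rewrite -big_split; apply: eq_big_nat => j /andP[lt_kj _] /=.
rewrite -mulnDl; congr (_ * _)%N.
have -> : (j - k = (j - k.+1).+1)%N by lia.
by rewrite !addnS /= binS.
Qed.

Lemma pochhammer_bin (a t : nat) : (0 < a)%N ->
  pochhammer a%:R t = ('C((a + t).-1, t) * t`!)%:R :> rat.
Proof.
move=> a_gt0; rewrite bin_ffact ffact_prod natr_prod (reindex_inj rev_ord_inj) /=.
by apply: eq_bigr => i _; have lt_it := ltn_ord i; rewrite -natrD; congr _%:R; lia.
Qed.

Theorem theorem1p4 (m n a : nat) (hm : (2 <= m)%N) (hn : (1 <= n)%N)
    (ha : (1 <= a)%N) :
  (num_syt (battery_shape (nseq n m) a 2))%:R =
  (num_syt (young_diagram (nseq n m)))%:R *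
    hypergeometric n [:: a%:R; m%:R; - n%:R] [:: 1; - (m * n)%:R] 1 :> rat.
Proof.
rewrite battery_shape_notched num_syt_notched_battery // young_rect_notched.
rewrite natr_sum /hypergeometric big_distrr /=; apply: eq_big_nat => t /andP[_ le_tn].
rewrite !big_cons !big_nil !mulr1 expr1n div1r subn0 natrM num_syt_notched //; last lia.
rewrite (pochhammer_bin t ha) [(_ * t`!)%:R]natrM.
have t0 : t`!%:R != 0 :> rat by rewrite pnatr_eq0 -lt0n fact_gt0.
by move: (_^-1) => D; field.
Qed.
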